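(* Let $\theta\in(0,1]$ and let $(\mathcal{A}_x)_{x}$ be a family of sets of positive integers satisfying Condition A with parameter $\theta$. Fix $\alpha\in(0,1)$, $\varepsilon>0$ and constants $A>0$, $B>0$. Then, uniformly for all real $x'$ with $x^{\varepsilon}<x'<x$ and all integers $h$ with $-Bx<h<\alpha' x'/2$, we have \[ \frac1x\sum_{x'\le n\le x}\sum_{a\in \mathcal{A}_x}\Bigg| \sum_{\substack{0\le l\le n\\ l\equiv v \ (\mathrm{mod}\ a)}} \binom nl \alpha^l (1-\alpha)^{n-l}- \frac 1{a} \Bigg|=O\left(x^{-\frac12(1-\theta)}(\log x)^{-A}\right), \] where either $v=h$ and $\alpha'=\alpha$, or $v=n-h$ and $\alpha'=1-\alpha$ (both choices are allowed; the sum over $n$ runs over integers).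
   Context: Notation: $f\ll g$ or $f=O(g)$ means $|f|\le Cg$ for a constant $C$ independent of the varying parameters (here it may depend on $\alpha,\varepsilon,A,B,\theta$ and the family). Condition A with parameter $\theta\in(0,1]$: a family $(\mathcal{A}_x)_{x>0}$ of sets of positive integers satisfies it if (i) there is a constant $A_0>0$ with $a\ll x^{A_0}$ for every $a\in\mathcal{A}_x$, and (ii) for every $\varepsilon>0$ and every $A>0$ one has $|\mathcal{A}_x\cap[1,y]|\ll y^{\theta}(\log y)^{-A}$ for all $y\gg x^{\varepsilon}$. *)

(* Defs.v *)
From HB Require Import structures.
From mathcomp Require Import all_boot all_order all_algebra.
From mathcomp Require Import finmap.
From mathcomp Require Import all_classical all_reals all_analysis.

Set Implicit Arguments.
Unset Strict Implicit.
Unset Printing Implicit Defensive.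

Import Order.TTheory GRing.Theory Num.Theory.
Import numFieldNormedType.Exports.

Local Open Scope classical_set_scope.
Local Open Scope ring_scope.

(* The family is indexed by all reals, but only indices x > 1 are constrained,
   and [y] ranges over reals > 1: this is where the logarithms are positive.
   "y >> x^eps" means y >= c x^eps for an arbitrary fixed c > 0, on which the
   constant C may depend. *)
Definition conditionA (R : realType) (theta : R) (calA : R -> set nat) : Prop :=
  (exists A0 C : R, [/\ 0 < A0, 0 < C &
     forall (x : R) (a : nat), 1 < x -> calA x a -> a%:R <= C * x `^ A0]) /\
  (forall eps A c : R, 0 < eps -> 0 < A -> 0 < c ->
     exists2 C : R, 0 < C &
       forall x y : R, 1 < x -> 1 < y -> c * x `^ eps <= y ->
         (#|` fset_set (calA x `&` [set a : nat | a%:R <= y]) |)%:R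
           <= C * (y `^ theta * ln y `^ (- A))).

(* The congruence is taken in the integers, as v may be negative. *)
Definition binom_residue (R : realType) (alpha : R) (n a : nat) (v : int) : R :=
  \sum_(l < n.+1 | (l%:Z == v %[mod a%:Z])%Z)
     'C(n, l)%:R * alpha ^+ l * (1 - alpha) ^+ (n - l).

(* Both index sets are finite in the intended use (S = calA x with x > 1), so
   the finitely supported sums \sum_(_ \in _) are the actual sums. *)
Definition mean_discrepancy (R : realType) (alpha : R) (S : set nat)
    (v : nat -> int) (x' x : R) : R :=
  x^-1 * \sum_(n \in [set n : nat | x' <= n%:R <= x])
           \sum_(a \in S) `| binom_residue alpha n a (v n) - a%:R^-1 |.

(* Main.v *)
(** Write [p_n(l)] for the binomial weights. Since
    [(n+1) alpha (1-alpha) (p_n(l) - p_n(l+1)) = p_{n+1}(l+1) (l+1 - (n+1) alpha)],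
    the variance of the binomial law bounds the total variation of [p_n] by
    [1 / sqrt((n+1) alpha (1-alpha))], and this total variation bounds the
    discrepancy of every residue class modulo every [a]. Averaged over [n <= x],
    this settles [a <= sqrt x]: there are few such [a] in the family.
    For [a > sqrt x] the sum over the class and [1/a] are bounded separately.
    The terms [l <= h] lie in the lower tail and are exponentially small
    (Chernoff). For the terms [l > h] one sums over [n] first: [sum_n p_n(l)]
    is at most [1/alpha] for each [l], and [l - h] runs through at most
    [(1+B) x / a] multiples of [a]. So each [a] contributes [O(1/a)] on average,
    and [sum_{a > sqrt x} 1/a] is estimated dyadically from Condition A.
    The case [v = n - h] follows from the symmetry [l -> n - l],
    [alpha -> 1 - alpha]. *)
Require Import Defs.
From HB Require Import structures.
From mathcomp Require Import all_boot all_order all_algebra.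
From mathcomp Require Import finmap.
From mathcomp Require Import all_classical all_reals all_analysis.
From mathcomp Require Import ring lra zify.

Import Order.TTheory GRing.Theory Num.Theory.
Import numFieldNormedType.Exports.

Local Open Scope classical_set_scope.
Local Open Scope ring_scope.

Set Implicit Arguments.
Unset Strict Implicit.
Unset Printing Implicit Defensive.

(** * Binomial weights: recurrences, moments and total variation *)

Definition binom_wt (R : realType) (alpha : R) (n l : nat) : R :=
  'C(n, l)%:R * alpha ^+ l * (1 - alpha) ^+ (n - l).

Definition binom_mean (R : realType) (alpha : R) (n : nat) (g : nat -> R) : R :=
  \sum_(l < n.+1) binom_wt alpha n l * g l.

Lemma binom_wt_ge0 (R : realType) (alpha : R) (n l : nat) :
  0 <= alpha <= 1 -> 0 <= binom_wt alpha n l.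
Proof.
by move=> /andP[a0 a1]; rewrite !mulr_ge0 ?ler0n ?exprn_ge0// subr_ge0.
Qed.

Lemma binom_wt_small (R : realType) (alpha : R) (n l : nat) :
  (n < l)%N -> binom_wt alpha n l = 0.
Proof. by move=> nl; rewrite /binom_wt bin_small// !mul0r. Qed.

Lemma binom_wt_pascal (R : realType) (alpha : R) (n l : nat) :
  binom_wt alpha n.+1 l.+1
  = alpha * binom_wt alpha n l + (1 - alpha) * binom_wt alpha n l.+1.
Proof.
rewrite /binom_wt binS natrD subSS exprS; case: (ltnP l n) => ln.
  by rewrite -(subnSK ln) exprS; ring.
by rewrite (@bin_small n l.+1)//; ring.
Qed.

Lemma binom_wt_diag (R : realType) (alpha : R) (n l : nat) :
  l.+1%:R * binom_wt alpha n.+1 l.+1 = n.+1%:R * alpha * binom_wt alpha n l.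
Proof.
have := congr1 (fun k => k%:R : R) (mul_bin_diag n.+1 l).
rewrite /= !natrM /binom_wt subSS exprS => E.
by rewrite !mulrA -E; ring.
Qed.

(** Pascal's rule subtracted from [binom_wt_diag]: an increment in [l] becomes a deviation from the
    mean for [n.+1] trials, so moments control it. *)
Lemma binom_wt_diff (R : realType) (alpha : R) (n l : nat) :
  n.+1%:R * (alpha * (1 - alpha)) * (binom_wt alpha n l.+1 - binom_wt alpha n l)
  = - (binom_wt alpha n.+1 l.+1 * (l.+1%:R - n.+1%:R * alpha)).
Proof.
rewrite [in RHS]mulrBr [X in _ = - (X - _)]mulrC binom_wt_diag binom_wt_pascal.
by ring.
Qed.

Lemma binom_mean_widen (R : realType) (alpha : R) (n M : nat) (g : nat -> R) :
  (n < M)%N -> \sum_(l < M) binom_wt alpha n l * g l = binom_mean alpha n g.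
Proof.
move=> nM; rewrite /binom_mean.
rewrite (big_ord_widen M (fun l => binom_wt alpha n l * g l) nM).
rewrite [RHS]big_mkcond; apply: eq_bigr => l _; case: ifPn => //.
by rewrite -leqNgt => nl; rewrite binom_wt_small ?mul0r.
Qed.

Lemma le_binom_mean (R : realType) (alpha : R) (n M : nat) (g : nat -> R) :
  0 <= alpha <= 1 -> (forall l, 0 <= g l) ->
  \sum_(l < M) binom_wt alpha n l * g l <= binom_mean alpha n g.
Proof.
move=> ha g0; rewrite -(@binom_mean_widen _ _ _ (M + n.+1)); last by lia.
rewrite big_split_ord /= lerDl sumr_ge0// => i _.
by rewrite mulr_ge0 ?binom_wt_ge0.
Qed.

(** Conditioning on one trial: a success shifts the argument of [g] by one. The moments follow from
    this by induction on [n]. *)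
Lemma binom_meanS (R : realType) (alpha : R) (n : nat) (g : nat -> R) :
  binom_mean alpha n.+1 g
  = alpha * binom_mean alpha n (g \o S) + (1 - alpha) * binom_mean alpha n g.
Proof.
rewrite {1}/binom_mean big_ord_recl /=.
under eq_bigr => i _ do rewrite /bump /= add1n binom_wt_pascal mulrDl -2!(mulrA _ (binom_wt _ _ _)).
rewrite big_split /= -!mulr_sumr.
rewrite -[X in _ = _ + _ * X](@binom_mean_widen _ _ _ n.+2)// [in RHS]big_ord_recl /=.
under [in RHS]eq_bigr => i _ do rewrite /bump /= add1n.
rewrite /binom_mean /binom_wt /= !bin0 !subn0 !expr0 exprS.
ring.
Qed.

Lemma binom_mean1 (R : realType) (alpha : R) (n : nat) (c : R) :
  binom_mean alpha n (fun=> c) = c.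
Proof.
elim: n => [|n IH].
  by rewrite /binom_mean big_ord1 /binom_wt bin0 !expr0 !mul1r.
by rewrite binom_meanS /comp IH; ring.
Qed.

(** The shift [c] is arbitrary because the induction uses its hypothesis at both [c] and [c + 1];
    [c = - (n%:R * alpha)] gives the variance. *)
Lemma binom_mean_sqr (R : realType) (alpha : R) (n : nat) (c : R) :
  binom_mean alpha n (fun l => (l%:R + c) ^+ 2)
  = n%:R * (alpha * (1 - alpha)) + (n%:R * alpha + c) ^+ 2.
Proof.
elim: n c => [|n IH] c.
  by rewrite /binom_mean big_ord1 /binom_wt bin0 !expr0 !mul1r /= !mul0r !add0r.
rewrite binom_meanS IH.
have -> : ((fun l => (l%:R + c) ^+ 2) \o S) = (fun l : nat => (l%:R + (c + 1)) ^+ 2).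
  by apply/funext => l /=; rewrite -natr1; congr (_ ^+ 2); ring.
by rewrite IH -natr1; ring.
Qed.

(* AM-GM: [|d| <= (d^2 / s + s) / 2] with [s] the standard deviation. *)
Lemma binom_mean_abs_dev (R : realType) (alpha : R) (n : nat) :
  0 < alpha < 1 -> (0 < n)%N ->
  binom_mean alpha n (fun l => `|l%:R - n%:R * alpha|)
  <= Num.sqrt (n%:R * (alpha * (1 - alpha))).
Proof.
move=> /andP[a0 a1] n0; set v := n%:R * (alpha * (1 - alpha)).
have v0 : 0 < v by rewrite /v !mulr_gt0 ?ltr0n// subr_gt0.
set s := Num.sqrt v; have s0 : 0 < s by rewrite sqrtr_gt0.
have sv : s * s = v by rewrite -expr2 sqr_sqrtr// ltW.
apply: (@le_trans _ _ (binom_mean alpha n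
    (fun l => ((2 * s)^-1 * (l%:R - n%:R * alpha) ^+ 2) + s / 2))).
  rewrite /binom_mean; apply: ler_sum => l _; apply: ler_wpM2l.
    by rewrite binom_wt_ge0// !ltW.
  set d := _ - _; rewrite -(real_normK (num_real d)) -subr_ge0.
  have -> : (2 * s)^-1 * `|d| ^+ 2 + s / 2 - `|d| = (2 * s)^-1 * (`|d| - s) ^+ 2.
    by field; lra.
  by rewrite mulr_ge0 ?sqr_ge0// invr_ge0; lra.
have -> : binom_mean alpha n
    (fun l => ((2 * s)^-1 * (l%:R - n%:R * alpha) ^+ 2) + s / 2)
  = (2 * s)^-1 * binom_mean alpha n (fun l => (l%:R - n%:R * alpha) ^+ 2)
    + binom_mean alpha n (fun=> s / 2).
  rewrite /binom_mean mulr_sumr -big_split /=; apply: eq_bigr => l _; ring.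
rewrite binom_mean1 binom_mean_sqr subrr -/v -sv.
have -> : (2 * s)^-1 * (s * s + 0 ^+ 2) + s / 2 = s by field; lra.
by [].
Qed.

(** Multiplying by the variance [v] of [n.+1] trials turns the increments into terms of the mean
    absolute deviation, which is at most [sqrt v]; only the term at 0 is missing. *)
Lemma binom_total_variation (R : realType) (alpha : R) (n M : nat) :
  0 < alpha < 1 ->
  \sum_(l < M) `|binom_wt alpha n l.+1 - binom_wt alpha n l|
  <= (Num.sqrt (n.+1%:R * (alpha * (1 - alpha))))^-1.
Proof.
move=> ha; have /andP[a0 a1] := ha; set v := n.+1%:R * _.
have v0 : 0 < v by rewrite /v !mulr_gt0 ?ltr0n// subr_gt0.
have s0 : 0 < Num.sqrt v by rewrite sqrtr_gt0.
have wa : 0 <= alpha <= 1 by rewrite !ltW.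
rewrite -(ler_pM2l v0) mulr_sumr.
under eq_bigr => l _.
  rewrite -{1}(gtr0_norm v0) -normrM binom_wt_diff normrN normrM.
  rewrite (ger0_norm (binom_wt_ge0 _ _ wa)).
  over.
have := @le_binom_mean _ alpha n.+1 M.+1 (fun l => `|l%:R - n.+1%:R * alpha|) wa
  (fun=> normr_ge0 _).
rewrite big_ord_recl /=.
under eq_bigr => i _ do rewrite /bump /= add1n.
have : 0 <= binom_wt alpha n.+1 0 * `|0 - n.+1%:R * alpha|.
  by rewrite mulr_ge0 ?binom_wt_ge0.
have := @binom_mean_abs_dev _ alpha n.+1 ha isT.
rewrite -/v => h1 h3 h2.
rewrite -[X in X / _](sqr_sqrtr (ltW v0)) expr2 mulfK ?gt_eqF//.
by apply: le_trans h1; apply: le_trans h2; rewrite lerDr.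
Qed.

(** * Sums over the number of trials, and the lower tail *)

(** In repeated trials the success count stays at [l] for a geometric time of mean [1 / alpha].
    Formally, this bound is preserved by Pascal's rule, as [alpha / alpha + (1 - alpha) / alpha = 1
    / alpha]. *)
Lemma binom_wt_sum_n (R : realType) (alpha : R) (N l : nat) :
  0 < alpha <= 1 -> \sum_(n < N) binom_wt alpha n l <= alpha^-1.
Proof.
move=> /andP[a0 a1]; have ai0 : 0 < alpha^-1 by rewrite invr_gt0.
have aV : alpha * alpha^-1 = 1 by rewrite mulfV// gt_eqF.
elim: N l => [|N IH] l; first by rewrite big_ord0 ltW.
rewrite big_ord_recl /=; case: l => [|l].
  have -> : \sum_(i < N) binom_wt alpha (bump 0 i) 0
          = (1 - alpha) * \sum_(i < N) binom_wt alpha i 0.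
    rewrite mulr_sumr; apply: eq_bigr => i _.
    by rewrite /bump add1n /binom_wt !bin0 !subn0 exprS; ring.
  have : (1 - alpha) * \sum_(i < N) binom_wt alpha i 0 <= (1 - alpha) * alpha^-1.
    by apply: ler_wpM2l (IH _); lra.
  rewrite /binom_wt bin0 !expr0; lra.
under eq_bigr => i _ do rewrite /bump add1n binom_wt_pascal.
rewrite binom_wt_small// add0r big_split /= -!mulr_sumr.
have := ler_wpM2l (ltW a0) (IH l).
have : (1 - alpha) * \sum_(i < N) binom_wt alpha i l.+1 <= (1 - alpha) * alpha^-1.
  by apply: ler_wpM2l (IH _); lra.
lra.
Qed.

Lemma binom_mean_geom (R : realType) (alpha z : R) (n : nat) :
  binom_mean alpha n (fun l => z ^+ l) = (1 - alpha + alpha * z) ^+ n.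
Proof.
rewrite exprDn /binom_mean; apply: eq_bigr => l _.
by rewrite /binom_wt exprMn -mulr_natl; ring.
Qed.

(** Chernoff's method with weight [expR (b - l)], at least 1 on the tail. The generating function
    gives the decay rate [alpha * (1 - expR (-1))], from which [b] takes back [alpha / 2]. *)
Lemma binom_lower_tail (R : realType) (alpha : R) (n : nat) (h : int) :
  0 < alpha < 1 -> h%:~R <= alpha * n%:R / 2 ->
  \sum_(l < n.+1 | l%:Z <= h) binom_wt alpha n l
  <= expR (- (alpha * (2^-1 - expR (-1))) * n%:R).
Proof.
move=> /andP[a0 a1] hn; set b := alpha * n%:R / 2.
have wa : 0 <= alpha <= 1 by rewrite !ltW.
have e0 := expR_gt0 (-1 : R).
apply: (@le_trans _ _ (expR b * binom_mean alpha n (fun l => expR (-1) ^+ l))).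
  rewrite /binom_mean mulr_sumr big_mkcond; apply: ler_sum => l _.
  have w0 := binom_wt_ge0 n l wa.
  case: ifPn => hl; last by apply: mulr_ge0 (expR_ge0 _) (mulr_ge0 w0 _); rewrite exprn_ge0 ?expR_ge0.
  rewrite mulrCA ler_peMr// -expRM_natl -expRD -{1}expR0 ler_expR.
  have : (l%:Z)%:~R <= h%:~R :> R by rewrite ler_int.
  rewrite /b -[_%:~R]/(l%:R); lra.
rewrite binom_mean_geom.
apply: (@le_trans _ _ (expR b * expR (- alpha * (1 - expR (-1))) ^+ n)).
  apply: ler_wpM2l; first exact/ltW/expR_gt0.
  apply: lerXn2r; rewrite ?nnegrE.
  - by rewrite addr_ge0 ?mulr_ge0 ?ltW// subr_gt0.
  - exact/ltW/expR_gt0.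
  - by apply: le_trans (expR_ge1Dx _); lra.
rewrite -expRM_natl -expRD ler_expR /b; lra.
Qed.

(** * Equidistribution in residue classes *)

(** In each block of [a] consecutive integers, the value at offset [r] differs from the block
    average by at most the variation of [f] over the block. *)
Lemma residue_sum_deviation (R : realType) (f : nat -> R) (a m r : nat) :
  (r < a)%N ->
  `|\sum_(j < m) f (j * a + r)%N - a%:R^-1 * \sum_(l < m * a) f l|
  <= \sum_(l < m * a) `|f l.+1 - f l|.
Proof.
move=> ra; have a0 : (0 < a)%N by apply: leq_ltn_trans ra.
have blocks (F : nat -> R) :
    \sum_(l < m * a) F l = \sum_(j < m) \sum_(i < a) F (j * a + i)%N.
  rewrite -(big_mkord xpredT) big_nat_mul big_mkord; apply: eq_bigr => j _.
  rewrite -{1}[(j * a)%N]add0n big_addn mulSn addnK big_mkord.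
  by apply: eq_bigr => i _; rewrite addnC.
have osc (b r1 r2 : nat) : (r1 <= r2 < a)%N ->
    `|f (b + r2)%N - f (b + r1)%N|
    <= \sum_(i < a) `|f (b + i).+1 - f (b + i)%N|.
  move=> /andP[r12 r2a].
  rewrite -(telescope_sumr (fun i => f (b + i)%N) r12).
  apply: le_trans (ler_norm_sum _ _ _) _.
  under eq_bigr => i _ do rewrite addnS.
  rewrite -(big_mkord xpredT (fun i => `|f (b + i).+1 - f (b + i)%N|)).
  rewrite (@big_cat_nat _ _ _ r1 0 a)//=; last by lia.
  rewrite (@big_cat_nat _ _ _ r2 r1 a)//=; last by lia.
  by rewrite addrCA lerDl addr_ge0 ?sumr_ge0.
rewrite (blocks f) (blocks (fun l => `|f l.+1 - f l|)) mulr_sumr -sumrB.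
apply: le_trans (ler_norm_sum _ _ _) _; apply: ler_sum => j _.
set V := \sum_(i < a) _.
have aR : (a%:R : R) != 0 by rewrite pnatr_eq0 -lt0n.
have -> : f (j * a + r)%N - a%:R^-1 * \sum_(i < a) f (j * a + i)%N
        = a%:R^-1 * \sum_(i < a) (f (j * a + r)%N - f (j * a + i)%N).
  rewrite sumrB sumr_const card_ord mulrBr -[f _ *+ a]mulr_natl mulrA.
  by rewrite mulVf// mul1r.
rewrite normrM gtr0_norm ?invr_gt0 ?ltr0n// mulrC ler_pdivrMr ?ltr0n//.
apply: le_trans (ler_norm_sum _ _ _) _.
rewrite mulr_natr -[X in _ <= _ *+ X]card_ord -sumr_const; apply: ler_sum => i _.
have ia := ltn_ord i.
by case: (leqP i r) => ir; last rewrite distrC; apply: osc; lia.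
Qed.

Lemma binom_residueE (R : realType) (alpha : R) (n a : nat) (v : int) :
  binom_residue alpha n a v
  = \sum_(l < n.+1 | (l%:Z == v %[mod a%:Z])%Z) binom_wt alpha n l.
Proof. by []. Qed.

(** The class as an arithmetic progression, the form required by [residue_sum_deviation]. The range
    of [j] may overshoot, since the weights vanish beyond [n]. *)
Lemma binom_residue_class (R : realType) (alpha : R) (n a : nat) (v : int) :
  (0 < a)%N ->
  binom_residue alpha n a v
  = \sum_(j < n.+1) binom_wt alpha n (j * a + `|(v %% a)%Z|).
Proof.
move=> a0; rewrite binom_residueE; set r := `|(v %% a)%Z|%N.
have rE : (v %% a)%Z = r%:Z by rewrite /r gez0_abs// modz_ge0//; lia.
have ra : (r < a)%N.
  by have := ltz_pmod v (_ : 0 < a%:Z); rewrite rE; lia.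
have lE (l : nat) : (l%:Z == v %[mod a%:Z])%Z = (l %% a == r)%N.
  by rewrite rE modz_nat.
rewrite (eq_bigl _ _ (fun l : 'I_n.+1 => lE l)) big_mkcond.
pose F l := if (l %% a == r)%N then binom_wt alpha n l else 0.
transitivity (\sum_(l < n.+1 * a) F l).
  have le : (n.+1 <= n.+1 * a)%N by rewrite leq_pmulr.
  rewrite (big_ord_widen _ F le) [LHS]big_mkcond; apply: eq_bigr => l _.
  case: ifPn => //; rewrite -leqNgt => nl; rewrite /F; case: ifP => // _.
  by rewrite binom_wt_small.
rewrite -(big_mkord xpredT) big_nat_mul big_mkord; apply: eq_bigr => j _.
rewrite -{1}[(j * a)%N]add0n big_addn mulSn addnK big_mkord.
rewrite (bigD1 (Ordinal ra))//= big1 ?addr0; last first.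
  move=> i ir; rewrite /F addnC modnMDl modn_small//.
  by rewrite -(inj_eq val_inj) /= in ir; rewrite (negbTE ir).
by rewrite /F addnC modnMDl modn_small// eqxx.
Qed.

Lemma binom_residue_deviation (R : realType) (alpha : R) (n a : nat) (v : int) :
  0 < alpha < 1 -> (0 < a)%N ->
  `|binom_residue alpha n a v - a%:R^-1|
  <= (Num.sqrt (n.+1%:R * (alpha * (1 - alpha))))^-1.
Proof.
move=> ha a0; rewrite binom_residue_class//.
have ra : (`|(v %% a)%Z| < a)%N.
  by have := ltz_pmod v (_ : 0 < a%:Z); have := modz_ge0 v (_ : a%:Z != 0); lia.
have one : \sum_(l < n.+1 * a) binom_wt alpha n l = 1.
  rewrite -[RHS](binom_mean1 alpha n) -(@binom_mean_widen _ _ _ (n.+1 * a)).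
    by apply: eq_bigr => l _; rewrite mulr1.
  by rewrite leq_pmulr.
have := @residue_sum_deviation _ (binom_wt alpha n) a n.+1 _ ra.
by rewrite one mulr1 => /le_trans; apply; apply: binom_total_variation.
Qed.

Lemma binom_residue_ge0 (R : realType) (alpha : R) (n a : nat) (v : int) :
  0 <= alpha <= 1 -> 0 <= binom_residue alpha n a v.
Proof. by move=> ha; rewrite sumr_ge0// => l _; apply: binom_wt_ge0. Qed.

Lemma binom_residue_sym (R : realType) (alpha : R) (n a : nat) (h : int) :
  binom_residue alpha n a (n%:Z - h) = binom_residue (1 - alpha) n a h.
Proof.
rewrite /binom_residue (reindex_inj rev_ord_inj) /=.
apply: eq_big => [l|l _].
  have ln := ltn_ord l; have -> : ((n.+1 - l.+1)%N : int) = n%:Z - l%:Z by lia.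
  rewrite !eqz_mod_dvd !dvdzE -(abszN (l%:Z - h)).
  by have -> : n%:Z - l%:Z - (n%:Z - h) = - (l%:Z - h) by lia.
have ln : (l <= n)%N by rewrite -ltnS.
by rewrite !subSS bin_sub// subKn// subKr; ring.
Qed.

(** * Residue classes summed over [n] *)

(** Here [l - h] is a positive multiple of [a] not exceeding [N - h]. The strict [h < l] avoids an
    extra 1 in the count, which would not be [O(x / a)] for [a] much larger than [x]. *)
Lemma card_residue_above (N a : nat) (h : int) : (0 < a)%N -> h <= N%:Z ->
  (\sum_(l < N.+1 | (h < l%:Z)%R && (l%:Z == h %[mod a%:Z])%Z) 1
   <= `|(N%:Z - h)%R| %/ a)%N.
Proof.
move=> a0; elim: N => [|N IH] hN.
  rewrite big_mkcond big_ord1 /=; case: ifPn => // /andP[h0].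
  rewrite eqz_mod_dvd dvdzE /= => /dvdn_leq; rewrite divn_gt0//; apply; lia.
rewrite big_mkcond big_ord_recr -big_mkcond /=.
have [->|hneq] := eqVneq h N.+1%:Z.
  rewrite ltxx /= addn0 big1// => l /andP[]; have := ltn_ord l; lia.
have hN' : h <= N%:Z by lia.
have -> : (h < N.+1%:Z) by lia.
have -> : (`|N.+1%:Z - h| = (`|N%:Z - h|).+1)%N by lia.
rewrite divnS// addnC eqz_mod_dvd dvdzE /=.
have -> : (`|N.+1%:Z - h| = (`|N%:Z - h|).+1)%N by lia.
by apply: leq_add; [case: (_ %| _)%N | apply: IH].
Qed.

Lemma expRN1_le_half (R : realType) : expR (-1) <= 2^-1 :> R.
Proof.
rewrite expRN lef_pV2 ?posrE ?expR_gt0//.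
by have := expR_ge1Dx (1 : R); lra.
Qed.

Lemma sum_residue_above (R : realType) (alpha : R) (N a : nat) (h : int) :
  0 < alpha < 1 -> (0 < a)%N -> h <= N%:Z ->
  \sum_(n < N.+1)
     \sum_(l < n.+1 | (h < l%:Z) && (l%:Z == h %[mod a%:Z])%Z) binom_wt alpha n l
  <= (N%:R - h%:~R) / (alpha * a%:R).
Proof.
move=> ha a0 hN; have /andP[al0 al1] := ha.
pose P (l : nat) := (h < l%:Z) && (l%:Z == h %[mod a%:Z])%Z.
(* Vanishing weights let the range of [l] be made independent of [n], so that the sums can be
   exchanged. *)
have -> : \sum_(n < N.+1) \sum_(l < n.+1 | P l) binom_wt alpha n l
        = \sum_(l < N.+1 | P l) \sum_(n < N.+1) binom_wt alpha n l.
  rewrite [RHS]exchange_big /=; apply: eq_bigr => n _.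
  rewrite (big_ord_widen_cond N.+1 P (binom_wt alpha n)) ?ltn_ord//.
  rewrite big_mkcond [RHS]big_mkcond; apply: eq_bigr => l _ /=.
  case: (P l) => //=; case: ltnP => // nl; rewrite binom_wt_small//.
apply: (@le_trans _ _ (\sum_(l < N.+1 | P l) alpha^-1)).
  by apply: ler_sum => l _; apply: binom_wt_sum_n; rewrite al0 ltW.
rewrite sumr_const -sum1_card.
have := card_residue_above a0 hN; set k := (\sum_(l < N.+1 | P l) 1)%N => hk.
have hka : (k * a <= `|(N%:Z - h)%R|)%N by rewrite -leq_divRL.
have : (k%:R * a%:R : R) <= N%:R - h%:~R.
  rewrite -natrM; apply: (@le_trans _ _ (`|(N%:Z - h)%R|%N%:R)).
    by rewrite ler_nat.
  by rewrite natr_absz ger0_norm ?subr_ge0// intrB.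
move=> H; rewrite ler_pdivlMr ?mulr_gt0 ?ltr0n//.
by rewrite -[_ *+ k]mulr_natl -mulrA mulKf ?gt_eqF.
Qed.

Lemma sum_binom_residue_le (R : realType) (alpha B x x' : R) (h : int) (a : nat) :
  0 < alpha < 1 -> (0 < a)%N -> 0 < x' -> x' <= x ->
  - B * x < h%:~R -> h%:~R < alpha * x' / 2 ->
  \sum_(n < (Num.truncn x).+1 | x' <= n%:R) binom_residue alpha n a h
  <= (1 + B) * x / (alpha * a%:R)
     + x * expR (- (alpha * (2^-1 - expR (-1))) * x').
Proof.
move=> ha a0 x'0 x'x hB hx'; have /andP[al0 al1] := ha.
set c := alpha * (2^-1 - expR (-1)); have c0 : 0 <= c.
  by rewrite (mulr_ge0 (ltW al0))// subr_ge0 expRN1_le_half.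
have x0 : 0 < x by apply: lt_le_trans x'x.
have /andP[Nx xN] := truncn_itv (ltW x0).
set N := Num.truncn x in Nx xN *.
have hN : h <= N%:Z.
  rewrite -ltzD1 -(ltr_int R) intrD; apply: lt_trans hx' _.
  move: xN; rewrite -natr1 -[N%:Z%:~R]/(N%:R) => xN.
  by apply: le_lt_trans xN; nra.
have wa : 0 <= alpha <= 1 by rewrite !ltW.
pose up n := \sum_(l < n.+1 | (h < l%:Z) && (l%:Z == h %[mod a%:Z])%Z)
               binom_wt alpha n l.
have up0 n : 0 <= up n by rewrite sumr_ge0// => l _; apply: binom_wt_ge0.
(* The class is cut at [h]; the part [l <= h] is a lower tail because
   [h < alpha * x' / 2 <= alpha * n / 2]. *)
have split n : x' <= n%:R -> binom_residue alpha n a h <= up n + expR (- c * x').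
  move=> x'n; rewrite binom_residueE (bigID (fun l : 'I_n.+1 => h < l%:Z)) /=.
  apply: lerD.
    by rewrite le_eqVlt; apply/orP; left; apply/eqP; apply: eq_bigl => l; rewrite andbC.
  apply: (@le_trans _ _ (\sum_(l < n.+1 | l%:Z <= h) binom_wt alpha n l)).
    rewrite big_mkcond [leRHS]big_mkcond; apply: ler_sum => l _.
    rewrite -leNgt; have w0 := binom_wt_ge0 n l wa.
    by case: (_ == _); case: (l%:Z <= h).
  apply: (le_trans (@binom_lower_tail _ alpha n h ha _)).
    by apply: ltW (lt_le_trans hx' _); nra.
  by rewrite ler_expR -/c !mulNr lerN2 ler_wpM2l.
apply: (@le_trans _ _ (\sum_(n < N.+1) up n
    + \sum_(n < N.+1 | x' <= n%:R) expR (- c * x'))).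
  apply: (@le_trans _ _ (\sum_(n < N.+1 | x' <= n%:R) (up n + expR (- c * x')))).
    by apply: ler_sum => n; apply: split.
  rewrite big_split lerD2r big_mkcond; apply: ler_sum => n _.
  by case: ifP.
apply: lerD.
  apply: le_trans (sum_residue_above ha a0 hN) _.
  apply: ler_wpM2r; first by rewrite invr_ge0 mulr_ge0// ltW.
  by move: hB; rewrite mulNr; lra.
(* The index [n = 0] is excluded by [0 < x'], so at most [N <= x] terms remain. *)
rewrite big_mkcond big_ord_recl /= (lt_geF x'0) add0r -big_mkcond /=.
apply: (@le_trans _ _ (\sum_(i < N) expR (- c * x'))).
  rewrite big_mkcond; apply: ler_sum => n _; case: ifP => // _; exact: expR_ge0.
by rewrite sumr_const card_ord -mulr_natl ler_wpM2r ?expR_ge0.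
Qed.

(** * Elementary estimates *)

Lemma powR_le_expR (R : realType) (K e c : R) : 0 < K -> 0 < e -> 0 < c ->
  exists2 C : R, 0 < C & forall x : R, 0 < x -> x `^ K <= C * expR (c * x `^ e).
Proof.
(* This [t] satisfies [K / e * t = c], which produces the exponent [c * x ^ e]; the witness collects
   the remaining constants. *)
move=> K0 e0 c0; set t := c * e / K.
have t0 : 0 < t by rewrite /t divr_gt0 ?mulr_gt0.
exists (expR (- (K / e * (1 + ln t)))); first exact: expR_gt0.
move=> x x0; rewrite -expRD {1}/powR gt_eqF// ler_expR.
have u0 : 0 < x `^ e by apply: powR_gt0.
(* The tangent line of [ln] at [1], taken at the point [t * x `^ e]. *)
have : ln (x `^ e * t) <= x `^ e * t - 1.
  have := @le_ln1Dx _ (x `^ e * t - 1).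
  have -> : 1 + (x `^ e * t - 1) = x `^ e * t by ring.
  apply; have := mulr_gt0 u0 t0; lra.
rewrite lnM ?posrE// ln_powR => H.
have Ke : 0 < K / e by rewrite divr_gt0.
have := ler_wpM2l (ltW Ke) H.
have -> : K / e * (e * ln x + ln t) = K * ln x + K / e * ln t.
  by field; rewrite gt_eqF.
have -> : K / e * (x `^ e * t - 1) = c * x `^ e - K / e.
  by rewrite /t; field; rewrite !gt_eqF.
lra.
Qed.

(** Each dyadic block contributes at most [2 * K]: it has at most [K * (z * 2 ^+ J.+1)] members,
    each with inverse below [(z * 2 ^+ J)^-1]. *)
Lemma sum_inv_dyadic (R : realType) (s : seq nat) (z K : R) (J : nat) :
  0 < z ->
  (forall j : nat, \sum_(a <- s | a%:R <= z * 2 ^+ j) 1 <= K * (z * 2 ^+ j)) ->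
  \sum_(a <- s | z < a%:R <= z * 2 ^+ J) (a%:R)^-1 <= 2 * K * J%:R.
Proof.
move=> z0 hK; elim: J => [|J IH].
  rewrite big1 ?mulr0// => a; rewrite expr0 mulr1 => /andP[]; lra.
have zJ : 0 < z * 2 ^+ J by rewrite mulr_gt0// exprn_gt0.
rewrite (bigID (fun a : nat => a%:R <= z * 2 ^+ J)) /= -[J.+1%:R]natr1 mulrDr mulr1.
apply: lerD.
  apply: le_trans IH; rewrite big_mkcond [leRHS]big_mkcond.
  apply: ler_sum => a _; rewrite -andbA; case: (z < _) => //=.
  by case: (a%:R <= z * 2 ^+ J); rewrite ?andbT ?andbF//; case: ifP.
apply: (@le_trans _ _ (\sum_(a <- s | a%:R <= z * 2 ^+ J.+1) (z * 2 ^+ J)^-1 * 1)).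
  rewrite big_mkcond [leRHS]big_mkcond; apply: ler_sum => a _.
  have b0 : 0 <= (z * 2 ^+ J)^-1 by rewrite invr_ge0 ltW.
  rewrite mulr1; case: (a%:R <= z * 2 ^+ J.+1); rewrite ?andbF ?andbT//=.
  case: ifP => [/andP[_]|_] //; rewrite -ltNge => ba.
  by rewrite lef_pV2 ?posrE ?(ltW ba)// (lt_trans zJ).
rewrite -mulr_sumr mulrC ler_pdivrMr//; apply: le_trans (hK J.+1) _.
by rewrite exprS; lra.
Qed.

Lemma sum_inv_sqrt (R : realType) (M : nat) :
  \sum_(n < M) (Num.sqrt n.+1%:R)^-1 <= 2 * Num.sqrt M%:R :> R.
Proof.
elim: M => [|M IH]; first by rewrite big_ord0 mulr_ge0// sqrtr_ge0.
rewrite big_ord_recr /=.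
have s0 : 0 < Num.sqrt (M.+1%:R : R) by rewrite sqrtr_gt0 ltr0n.
have t0 := sqrtr_ge0 (M%:R : R).
have s2 := sqr_sqrtr (ler0n R M.+1); have t2 := sqr_sqrtr (ler0n R M).
set s := Num.sqrt M.+1%:R in s0 s2 *; set t := Num.sqrt M%:R in t0 t2 IH *.
(* The bound telescopes; since [s ^+ 2 - t ^+ 2 = 1], this inequality amounts to
   [0 <= (s - t) ^+ 2]. *)
suff : s^-1 <= 2 * s - 2 * t by lra.
rewrite -(ler_pM2r s0) mulVf ?gt_eqF//.
have : s ^+ 2 = t ^+ 2 + 1 by rewrite s2 t2 natr1.
have := sqr_ge0 (s - t); nra.
Qed.

(** * Finite sets and consequences of Condition A *)

Lemma natset_le_finite (R : realType) (S : set nat) (y : R) :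
  (forall a, S a -> a%:R <= y) -> finite_set S.
Proof.
move=> Sy; apply: (@sub_finite_set _ _ `I_(Num.truncn y).+1); last exact: finite_II.
move=> a /Sy ay /=; have y0 : 0 <= y by apply: le_trans ay.
by rewrite ltnS truncn_ge_nat.
Qed.

Lemma card_fset_set_le (R : realType) (S : set nat) (y : R) : finite_set S ->
  (#|` fset_set (S `&` [set a : nat | a%:R <= y]) |)%:R
  = \sum_(a <- fset_set S | a%:R <= y) 1 :> R.
Proof.
move=> Sfin.
rewrite big_const_seq iter_addr_0 -size_filter; congr (_ *+ _).
apply: perm_size; apply: uniq_perm; rewrite ?filter_uniq ?fset_uniq// => a.
rewrite mem_filter !in_fset_set//; last exact: finite_setIl.
by apply/idP/andP; rewrite !inE => -[].
Qed.

Lemma sum_fset_set_nat (R : realType) (x x' : R) (F : nat -> R) : 0 <= x ->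
  \sum_(n \in [set n : nat | x' <= n%:R <= x]) F n
  = \sum_(n < (Num.truncn x).+1 | x' <= n%:R) F n.
Proof.
move=> x0; set S := [set n | _].
have Sfin : finite_set S by apply: (@natset_le_finite _ _ x) => a /andP[].
rewrite fsbig_finite//= -(big_mkord (fun n => x' <= n%:R)) -[RHS]big_filter.
apply: perm_big; apply: uniq_perm; rewrite ?filter_uniq ?iota_uniq ?fset_uniq//.
move=> n; rewrite mem_filter in_fset_set// mem_index_iota ltnS truncn_ge_nat//.
by apply/idP/idP; rewrite inE.
Qed.

(** For [2 <= x] the implied constant is absorbed by the exponent: [C <= 2 ^ m <= x ^ m] with
    [m = (Num.truncn C).+1]. *)
Lemma conditionA_bounded (R : realType) (theta : R) (calA : R -> set nat) :
  conditionA theta calA ->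
  exists2 A1 : R, 0 < A1 &
    forall (x : R) (a : nat), 2 <= x -> calA x a -> a%:R <= x `^ A1.
Proof.
move=> [[A0 [C [A00 C0 hA]]] _].
exists (A0 + (Num.truncn C).+1%:R); first by rewrite addr_gt0 ?ltr0n.
move=> x a x2 xa; have x1 : 1 < x by lra.
apply: le_trans (hA x a x1 xa) _.
rewrite addrC powRD; last by apply/implyP => _; rewrite gt_eqF//; lra.
apply: ler_wpM2r; first exact: powR_ge0.
rewrite powR_mulrn; last lra.
have /andP[_ CN] := truncn_itv (ltW C0).
apply: (le_trans (ltW CN)); apply: (@le_trans _ _ (2 ^+ (Num.truncn C).+1)).
  by rewrite -natrX ler_nat ltnW// ltn_expl.
by apply: lerXn2r; rewrite ?nnegrE//; lra.
Qed.

Lemma conditionA_finite (R : realType) (theta : R) (calA : R -> set nat) (x : R) :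
  conditionA theta calA -> 2 <= x -> finite_set (calA x).
Proof.
move=> /conditionA_bounded[A1 _ hA] x2.
by apply: (@natset_le_finite _ _ (x `^ A1)) => a; apply: hA.
Qed.

(** Condition A with exponent 1/2. As [ln y >= ln x / 2], replacing [ln y] by [ln x] costs a factor
    [2 ^ A]. *)
Lemma conditionA_count (R : realType) (theta : R) (calA : R -> set nat) (A : R) :
  conditionA theta calA -> 0 < A ->
  exists2 C : R, 0 < C & forall x y : R, 2 <= x -> x `^ 2^-1 <= y ->
    \sum_(a <- fset_set (calA x) | a%:R <= y) 1
    <= C * (y `^ theta * ln x `^ (- A)).
Proof.
move=> hA A0; have [C C0 hC] := (proj2 hA) 2^-1 A 1 ltac:(lra) A0 ltr01.
exists (C * 2^-1 `^ (- A)); first by rewrite mulr_gt0// powR_gt0//; lra.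
move=> x y x2 xy; have x1 : 1 < x by lra.
have lx : 0 < ln x by rewrite ln_gt0.
have y1 : 1 < y.
  apply: lt_le_trans xy; rewrite /powR gt_eqF; last lra.
  by rewrite expR_gt1 mulr_gt0// invr_gt0.
rewrite -card_fset_set_le; last exact: conditionA_finite hA x2.
apply: (le_trans (hC x y x1 y1 _)); first by rewrite mul1r.
rewrite -mulrA; apply: ler_wpM2l; first exact: ltW.
rewrite mulrCA; apply: ler_wpM2l; first exact: powR_ge0.
rewrite -powRM; [|lra|exact: ltW].
have ly : 2^-1 * ln x <= ln y.
  by rewrite -ln_powR ler_ln ?posrE// ?powR_gt0//; lra.
rewrite !powRN lef_pV2 ?posrE ?powR_gt0//; [|lra..].
by apply: ge0_ler_powR; rewrite ?nnegrE//; lra.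
Qed.

Lemma sum_inv_conditionA (R : realType) (theta : R) (calA : R -> set nat) (A : R) :
  0 < theta <= 1 -> conditionA theta calA -> 0 < A ->
  exists2 C : R, 0 < C & forall x : R, 2 <= x ->
    \sum_(a <- fset_set (calA x) | x `^ 2^-1 < a%:R) (a%:R)^-1
    <= C * (x `^ 2^-1 `^ (theta - 1) * ln x `^ (- A)).
Proof.
move=> /andP[th0 th1] hA A0.
(* The power [A + 1] pays for the [O(ln x)] dyadic blocks. *)
have [C C0 hC] := conditionA_count hA (addr_gt0 A0 ltr01).
have [A1 A10 hA1] := conditionA_bounded hA.
have l2 : 0 < ln (2 : R) by rewrite ln_gt0//; lra.
exists (2 * C * ((A1 + 1) / ln 2)).
  by apply: mulr_gt0; [apply: mulr_gt0 | apply: divr_gt0; rewrite ?addr_gt0].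
move=> x x2; have x0 : 0 < x by lra.
have lx : ln 2 <= ln x by rewrite ler_ln ?posrE//; lra.
have lx0 : 0 < ln x by lra.
set z := x `^ 2^-1; have z0 : 0 < z by rewrite powR_gt0.
have z1 : 1 <= z by rewrite /z /powR gt_eqF// -expR0 ler_expR mulr_ge0// ?invr_ge0// ltW.
(* [w] is the base-2 logarithm of [x ^ A1], so [J] doublings of [z] pass every member of the
   family. *)
set w := A1 / ln 2 * ln x; set J := (Num.truncn w).+1.
have w0 : 0 <= w by rewrite mulr_ge0 ?divr_ge0// ltW.
have /andP[Jw wJ] := truncn_itv w0; rewrite -/J in wJ.
have Jx : J%:R <= (A1 + 1) / ln 2 * ln x.
  rewrite /J -[_.+1%:R]natr1 mulrDl mulrDl -/w; apply: lerD => //.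
  by rewrite mul1r mulrC ler_pdivlMr// mul1r.
have xJ : x `^ A1 <= z * 2 ^+ J.
  apply: (@le_trans _ _ (2 ^+ J)); last by rewrite ler_peMl// exprn_ge0.
  rewrite /powR gt_eqF// -[X in _ <= X ^+ _](@lnK _ 2) ?posrE// -expRM_natl ler_expR.
  move: (ltW wJ); rewrite /w -(ler_pM2r l2).
  have -> // : A1 / ln 2 * ln x * ln 2 = A1 * ln x by field; rewrite gt_eqF.
(* As [theta <= 1], the count [y ^ theta] is at most [z ^ (theta - 1) * y] for [y >= z], which is
   linear in [y]. *)
pose K := C * (z `^ (theta - 1) * ln x `^ (- (A + 1))).
have hK (j : nat) :
    \sum_(a <- fset_set (calA x) | a%:R <= z * 2 ^+ j) 1 <= K * (z * 2 ^+ j).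
  have j1 : 1 <= 2 ^+ j :> R by rewrite exprn_ege1//; lra.
  apply: (le_trans (hC x _ x2 _)); first by rewrite ler_peMr// ltW.
  rewrite /K -mulrA; apply: ler_wpM2l; first exact: ltW.
  rewrite -mulrA [X in _ <= _ * X]mulrC mulrA.
  apply: ler_wpM2r; first exact: powR_ge0.
  rewrite (powRM _ (ltW z0) (le_trans ler01 j1)).
  rewrite mulrA; apply: ler_pM; rewrite ?powR_ge0//; last exact: ler1_powR.
  by rewrite mulrC mulr_powRB1 // ?ltW// ; lra.
have := @sum_inv_dyadic _ (fset_set (calA x)) z K J z0 hK.
have -> : \sum_(a <- fset_set (calA x) | z < a%:R <= z * 2 ^+ J) (a%:R)^-1
        = \sum_(a <- fset_set (calA x) | z < a%:R) (a%:R)^-1 :> R.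
  rewrite big_seq_cond [RHS]big_seq_cond; apply: eq_bigl => a.
  case: (boolP (a \in _)) => //=; rewrite in_fset_set; last first.
    exact: conditionA_finite hA x2.
  rewrite inE => /(hA1 _ _ x2) ax.
  by rewrite (le_trans ax xJ) andbT.
move/le_trans; apply.
have K0 : 0 <= 2 * K.
  by rewrite !mulr_ge0 ?powR_ge0// ltW.
apply: (le_trans (ler_wpM2l K0 Jx)); rewrite /K.
have -> : ln x `^ (- A) = ln x `^ (- (A + 1)) * ln x.
  rewrite -[X in _ * X](powRr1 (ltW lx0)) -powRD; last first.
    by apply/implyP => _; rewrite gt_eqF.
  by congr (_ `^ _); ring.
by rewrite le_eqVlt; apply/orP; left; apply/eqP; ring.
Qed.

(** * Bounding the mean discrepancy *)

(** Up to [sqrt x], the total variation bound averages over [n] to [O(x ^ (-1/2))] per modulus.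
    Beyond, [W] turns the exponential tail into a multiple of [1 / a], so all three terms there are
    [O(1 / a)]. *)
Lemma mean_discrepancy_split (R : realType) (alpha B x x' W : R) (h : int)
    (S : set nat) :
  0 < alpha < 1 -> 0 < B -> 2 <= x -> 0 < x' -> x' <= x ->
  - B * x < h%:~R -> h%:~R < alpha * x' / 2 ->
  finite_set S -> (forall a, S a -> (0 < a)%N) ->
  (forall a, S a ->
     a%:R * expR (- (alpha * (2^-1 - expR (-1))) * x') <= W) ->
  mean_discrepancy alpha S (fun=> h) x' x
  <= 4 / Num.sqrt (alpha * (1 - alpha)) * (x `^ 2^-1)^-1
       * \sum_(a <- fset_set S | a%:R <= x `^ 2^-1) 1
     + ((1 + B) / alpha + W + 1)
       * \sum_(a <- fset_set S | x `^ 2^-1 < a%:R) (a%:R)^-1.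
Proof.
move=> ha B0 x2 x'0 x'x hB hx' Sfin Spos SW; have /andP[al0 al1] := ha.
have x0 : 0 < x by lra.
have wa : 0 <= alpha <= 1 by rewrite !ltW.
set q := alpha * (1 - alpha).
have q0 : 0 < q by rewrite mulr_gt0// subr_gt0.
have sq0 : 0 < Num.sqrt q by rewrite sqrtr_gt0.
set z := x `^ 2^-1; have z0 : 0 < z by rewrite powR_gt0.
have zE : z = Num.sqrt x by rewrite /z powR12_sqrt// ltW.
have zz : z * z = x by rewrite zE -expr2 sqr_sqrtr// ltW.
have /andP[Nx xN] := truncn_itv (ltW x0).
rewrite /mean_discrepancy sum_fset_set_nat ?(ltW x0)//.
set N := Num.truncn x in Nx xN *.
set D := fun n a => `|binom_residue alpha n a h - a%:R^-1|.
have -> : \sum_(n < N.+1 | x' <= n%:R) \sum_(a \in S) D n a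
  = \sum_(n < N.+1 | x' <= n%:R) \sum_(a <- fset_set S | a%:R <= z) D n a
    + \sum_(n < N.+1 | x' <= n%:R) \sum_(a <- fset_set S | z < a%:R) D n a.
  rewrite -big_split; apply: eq_bigr => n _.
  rewrite fsbig_finite//= (bigID (fun a : nat => a%:R <= z)) /=.
  by congr (_ + _); apply: eq_bigl => a; rewrite ltNge.
rewrite mulrDr; apply: lerD.
  set cnt := \sum_(a <- fset_set S | _) 1.
  have cnt0 : 0 <= cnt by rewrite sumr_ge0.
  have pos (n : nat) : 0 <= (Num.sqrt n.+1%:R)^-1 * (Num.sqrt q)^-1 * cnt.
    by rewrite mulr_ge0// mulr_ge0 ?invr_ge0 ?sqrtr_ge0.
  have small (n : nat) : \sum_(a <- fset_set S | a%:R <= z) D n a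
      <= (Num.sqrt n.+1%:R)^-1 * (Num.sqrt q)^-1 * cnt.
    rewrite mulr_sumr mulr1 big_seq_cond [leRHS]big_seq_cond.
    apply: ler_sum => a /andP[]; rewrite in_fset_set// inE => /Spos a0 _.
    apply: le_trans (binom_residue_deviation n h ha a0) _.
    by rewrite sqrtrM// invfM.
  apply: (@le_trans _ _ (x^-1 * (2 * Num.sqrt N.+1%:R * (Num.sqrt q)^-1 * cnt))).
    apply: ler_wpM2l; first by rewrite invr_ge0 ltW.
    apply: (@le_trans _ _ (\sum_(n < N.+1)
        (Num.sqrt n.+1%:R)^-1 * (Num.sqrt q)^-1 * cnt)).
      by rewrite big_mkcond; apply: ler_sum => n _; case: ifP.
    rewrite -!mulr_suml; apply: ler_wpM2r => //; apply: ler_wpM2r.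
      by rewrite invr_ge0 sqrtr_ge0.
    exact: sum_inv_sqrt.
  (* [N + 1 <= 4 * x]; this factor 2 and the one in [sum_inv_sqrt] make the constant 4. *)
  have sN : Num.sqrt N.+1%:R <= 2 * z.
    have -> : 2 * z = Num.sqrt (2 ^+ 2 * x).
      by rewrite sqrtrM ?exprn_ge0// sqrtr_sqr ger0_norm// zE.
    by rewrite ler_sqrt -?natr1; lra.
  rewrite mulrA; apply: ler_wpM2r => //.
  apply: (@le_trans _ _ (x^-1 * (2 * (2 * z) * (Num.sqrt q)^-1))).
    apply: ler_wpM2l; first by rewrite invr_ge0 ltW.
    by apply: ler_wpM2r; [rewrite invr_ge0 sqrtr_ge0 | apply: ler_wpM2l].
  rewrite -zz le_eqVlt; apply/orP; left; apply/eqP.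
  by field; rewrite !gt_eqF.
rewrite exchange_big /= !mulr_sumr big_seq_cond [leRHS]big_seq_cond.
apply: ler_sum => a /andP[]; rewrite in_fset_set// inE => Sa _.
have a0 := Spos _ Sa; have aR : 0 < a%:R :> R by rewrite ltr0n.
set E := expR (- (alpha * (2^-1 - expR (-1))) * x').
have tot : \sum_(n < N.+1 | x' <= n%:R) D n a
    <= (1 + B) * x / (alpha * a%:R) + x * E + x * a%:R^-1.
  apply: (@le_trans _ _ (\sum_(n < N.+1 | x' <= n%:R) binom_residue alpha n a h
      + \sum_(n < N.+1 | x' <= n%:R) a%:R^-1)).
    rewrite -big_split; apply: ler_sum => n _.
    apply: le_trans (ler_normB _ _) _.
    by rewrite !ger0_norm ?invr_ge0 ?binom_residue_ge0.
  apply: lerD; first exact: sum_binom_residue_le.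
  rewrite big_mkcond big_ord_recl /= (lt_geF x'0) add0r -big_mkcond /=.
  apply: (@le_trans _ _ (\sum_(i < N) a%:R^-1)).
    by rewrite big_mkcond; apply: ler_sum => n _; case: ifP; rewrite ?invr_ge0.
  by rewrite sumr_const card_ord -[_ *+ N]mulr_natl ler_wpM2r ?invr_ge0.
apply: (@le_trans _ _ (x^-1 * ((1 + B) * x / (alpha * a%:R) + x * E + x * a%:R^-1))).
  by apply: ler_wpM2l; rewrite // invr_ge0 ltW.
have -> : x^-1 * ((1 + B) * x / (alpha * a%:R) + x * E + x * a%:R^-1)
        = ((1 + B) / alpha + a%:R * E + 1) * a%:R^-1.
  by field; rewrite !gt_eqF.
apply: ler_wpM2r; first by rewrite invr_ge0.
by rewrite lerD2r lerD2l SW.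
Qed.

(** With [z = sqrt x], both halves of the split have size [z ^ (theta - 1)]: [z^-1] times a count
    [z ^ theta] for small moduli, and the dyadic sum for large ones. *)
Lemma mean_discrepancy_fixed_residue (R : realType) (theta : R)
    (calA : R -> set nat) (alpha eps A B : R) :
  0 < theta <= 1 ->
  (forall (x : R) (a : nat), 0 < x -> calA x a -> (0 < a)%N) ->
  conditionA theta calA -> 0 < alpha < 1 -> 0 < eps -> 0 < A -> 0 < B ->
  exists2 C : R, 0 < C &
    forall (x x' : R) (h : int),
      1 < x -> x `^ eps < x' -> x' < x -> - B * x < h%:~R ->
      h%:~R < alpha * x' / 2 ->
      mean_discrepancy alpha (calA x) (fun=> h) x' x
        <= C * (x `^ (- (1 / 2) * (1 - theta)) * ln x `^ (- A)).
Proof.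
move=> hth Apos hA ha e0 A0 B0; have /andP[al0 al1] := ha.
have [C1 C10 hC1] := conditionA_count hA A0.
have [C2 C20 hC2] := sum_inv_conditionA hth hA A0.
have [A1 A10 hA1] := conditionA_bounded hA.
set c := alpha * (2^-1 - expR (-1)).
(* Strict positivity comes from [e > 2]. *)
have c0 : 0 < c.
  rewrite mulr_gt0// subr_gt0 expRN ltf_pV2 ?posrE ?expR_gt0//.
  by have := @expR_gt1Dx R 1 (oner_neq0 _); lra.
(* [W] bounds [a <= x ^ A1] times the tail, which decays like [expR (- c * x ^ eps)] because
   [x' > x ^ eps]. *)
have [W W0 hW] := powR_le_expR A10 e0 c0.
set q := Num.sqrt (alpha * (1 - alpha)).
have q0 : 0 < q by rewrite sqrtr_gt0 mulr_gt0// subr_gt0.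
set K2 := (1 + B) / alpha + W + 1.
have K20 : 0 < K2 by rewrite !addr_gt0// divr_gt0// addr_gt0.
have K10 : 0 < 4 / q by rewrite divr_gt0.
exists (4 / q * C1 + K2 * C2); first by rewrite addr_gt0// mulr_gt0.
move=> x x' h x1 ex x'x hB hx'.
have x0 : 0 < x by lra.
have lx : 0 < ln x by rewrite ln_gt0.
have e1 : 1 < x `^ eps by rewrite /powR gt_eqF// expR_gt1 mulr_gt0.
have x'0 : 0 < x' by lra.
(* For [x < 2] the sum is empty: no integer satisfies [1 < x' <= n <= x]. *)
case: (ltP x 2) => x2.
  rewrite /mean_discrepancy sum_fset_set_nat ?(ltW x0)//.
  rewrite big_pred0 ?mulr0 => [|n].
    apply: mulr_ge0; last by rewrite mulr_ge0 ?powR_ge0.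
    by rewrite addr_ge0// mulr_ge0// ltW.
  have n1 : (n%:R : R) <= 1.
    have N1 : Num.truncn x = 1%N by apply: truncn_def; lra.
    by rewrite (ler_nat R n 1) -N1 -ltnS.
  by apply/negbTE; rewrite -ltNge; lra.
set z := x `^ 2^-1; have z0 : 0 < z by rewrite powR_gt0.
have -> : x `^ (- (1 / 2) * (1 - theta)) = z `^ (theta - 1).
  by rewrite /z -powRrM; congr (_ `^ _); lra.
set L := ln x `^ (- A).
apply: (le_trans (@mean_discrepancy_split _ alpha B x x' W h (calA x)
    ha B0 x2 x'0 (ltW x'x) hB hx' (conditionA_finite hA x2) _ _)).
- by move=> a; apply: Apos.
- move=> a xa; apply: (@le_trans _ _ (x `^ A1 * expR (- c * x `^ eps))).
    apply: ler_pM; rewrite ?expR_ge0//; first exact: hA1.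
    by rewrite ler_expR !mulNr lerN2 ler_wpM2l// ltW.
  by rewrite mulNr expRN ler_pdivrMr ?expR_gt0// hW.
rewrite -/z -/q -/K2 [leRHS]mulrDl; apply: lerD.
  apply: (@le_trans _ _ (4 / q * z^-1 * (C1 * (z `^ theta * L)))).
    by apply: ler_wpM2l; [rewrite mulr_ge0 ?invr_ge0// ltW | apply: hC1].
  rewrite le_eqVlt; apply/orP; left; apply/eqP.
  rewrite powRB; last by apply/implyP => _; rewrite gt_eqF.
  by rewrite powRr1 ?ltW//; field; rewrite !gt_eqF.
rewrite -mulrA; apply: ler_wpM2l; first exact: ltW.
exact: hC2.
Qed.

Unset Implicit Arguments.

Theorem theorem1p1 (R : realType) (theta : R) (calA : R -> set nat)
    (alpha eps A B : R)
    (theta_range : 0 < theta <= 1)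
    (calA_pos : forall (x : R) (a : nat), 0 < x -> calA x a -> (0 < a)%N)
    (calA_condA : conditionA theta calA)
    (alpha_range : 0 < alpha < 1)
    (eps_gt0 : 0 < eps) (A_gt0 : 0 < A) (B_gt0 : 0 < B) :
  exists2 C : R, 0 < C &
    forall (x x' : R) (h : int),
      1 < x -> x `^ eps < x' -> x' < x -> - B * x < h%:~R ->
      (h%:~R < alpha * x' / 2 ->
         mean_discrepancy alpha (calA x) (fun=> h) x' x
           <= C * (x `^ (- (1 / 2) * (1 - theta)) * ln x `^ (- A))) /\
      (h%:~R < (1 - alpha) * x' / 2 ->
         mean_discrepancy alpha (calA x) (fun n => n%:Z - h) x' x
           <= C * (x `^ (- (1 / 2) * (1 - theta)) * ln x `^ (- A))).
Proof.
have alpha'_range : 0 < 1 - alpha < 1.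
  by have /andP[? ?] := alpha_range; apply/andP; split; lra.
have [C1 C10 hC1] := mean_discrepancy_fixed_residue theta_range calA_pos
  calA_condA alpha_range eps_gt0 A_gt0 B_gt0.
have [C2 C20 hC2] := mean_discrepancy_fixed_residue theta_range calA_pos
  calA_condA alpha'_range eps_gt0 A_gt0 B_gt0.
exists (C1 + C2); first exact: addr_gt0.
move=> x x' h x1 ex x'x hB.
have bound0 : 0 <= x `^ (- (1 / 2) * (1 - theta)) * ln x `^ (- A).
  by rewrite mulr_ge0 ?powR_ge0.
split=> hx'; rewrite mulrDl.
  by apply: le_trans (hC1 _ _ _ x1 ex x'x hB hx') _; rewrite lerDl (mulr_ge0 (ltW C20)).
(* Exchanging successes and failures reduces this case to [1 - alpha] with the fixed residue [h]. *)
have -> : mean_discrepancy alpha (calA x) (fun n => n%:Z - h) x' x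
        = mean_discrepancy (1 - alpha) (calA x) (fun=> h) x' x.
  congr (_ * _); apply: eq_fsbigr => n _; apply: eq_fsbigr => a _.
  by rewrite binom_residue_sym.
by apply: le_trans (hC2 _ _ _ x1 ex x'x hB hx') _; rewrite lerDr (mulr_ge0 (ltW C10)).
Qed.
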